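(* Let $t\ge 1$ be an integer and let $G$ be a graph on $n$ vertices with independence number $\alpha(G)\leq t$. Then $$(2t-1)\,{\rm b}(G)\leq (t-1)n+t\chi(G).$$
   Context: All graphs are finite, undirected, without loops or multiple edges, with at least one vertex. $\chi(G)$ is the chromatic number and $\alpha(G)$ the maximum size of an independent set of $G$. Let $c$ be a proper vertex coloring of $G$ using $k$ colors (every one of the $k$ colors is used). A vertex $u$ is a b-vertex (of $c$) if for each color $j\neq c(u)$, $u$ has a neighbor of color $j$. The coloring $c$ is a b-coloring if every color class contains a b-vertex. The b-chromatic number ${\rm b}(G)$ is the maximum number of colors used in a b-coloring of $G$. *)

(* Defs.v *)
From mathcomp Require Import all_boot.

Set Implicit Arguments.
Unset Strict Implicit.
Unset Printing Implicit Defensive.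

Record sgraph := SGraph {
  vertex :> finType;
  adj : rel vertex;
  adj_sym : symmetric adj;
  adj_irr : irreflexive adj
}.

Definition independent (G : sgraph) (A : {set G}) : bool :=
  [forall u in A, forall v in A, ~~ adj u v].

Definition independence_number (G : sgraph) : nat :=
  \max_(A : {set G} | independent A) #|A|.

(* The k available colors are the elements of 'I_k; a proper coloring need not
   use all of them, which is the separate condition [uses_all_colors]. *)
Definition proper_coloring (G : sgraph) (k : nat) (c : {ffun G -> 'I_k}) : bool :=
  [forall u, forall v, adj u v ==> (c u != c v)].

Definition uses_all_colors (G : sgraph) (k : nat) (c : {ffun G -> 'I_k}) : bool :=
  [forall i, exists u, c u == i].

Definition colorable (G : sgraph) (k : nat) : bool :=
  [exists c : {ffun G -> 'I_k}, proper_coloring c].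

Lemma ex_colorable (G : sgraph) : exists k, colorable G k.
Proof.
exists #|G|; apply/existsP; exists [ffun u => enum_rank u].
apply/forallP => u; apply/forallP => v; apply/implyP => uv.
by rewrite !ffunE (inj_eq enum_rank_inj); apply: contraTneq uv => ->; rewrite adj_irr.
Qed.

Definition chromatic_number (G : sgraph) : nat := ex_minn (ex_colorable G).

Definition b_vertex (G : sgraph) (k : nat) (c : {ffun G -> 'I_k}) (u : G) : bool :=
  [forall j, (j != c u) ==> [exists v, adj u v && (c v == j)]].

Definition b_coloring (G : sgraph) (k : nat) (c : {ffun G -> 'I_k}) : bool :=
  [&& proper_coloring c, uses_all_colors c &
      [forall i, exists u, (c u == i) && b_vertex c u]].

Lemma uses_all_colors_leq (G : sgraph) (k : nat) (c : {ffun G -> 'I_k}) :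
  uses_all_colors c -> k <= #|G|.
Proof.
move=> /forallP cP; rewrite -[k]card_ord; apply: leq_trans (leq_image_card c G).
apply/subset_leq_card/subsetP => i _; have /existsP[u /eqP <-] := cP i.
exact: image_f.
Qed.

(* The bound k <= #|G| only makes the range of k finite: it holds for every
   b-coloring, by [uses_all_colors_leq]. *)
Definition b_chromatic_number (G : sgraph) : nat :=
  \max_(k < #|G|.+1 | [exists c : {ffun G -> 'I_k}, b_coloring c]) k.

(* Main.v *)
(** Fix a b-coloring with k colors and a b-vertex in each class. The unique
    vertex of a singleton class is adjacent to every other chosen b-vertex.
    Give a class weight t if it is a singleton and weight 1 otherwise. In any
    proper coloring, the chosen b-vertices sharing a color have total weight at
    most t: either there is only one of them, or they form an independent set of
    vertices of weight 1. Hence the total weight is at most t times the chromatic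
    number. On the other hand, t - 1 times the size of a class plus its weight is
    always at least 2t - 1, and summing over the k classes gives the bound. *)

Require Import Defs.
From mathcomp Require Import all_boot.
From mathcomp Require Import zify.

Lemma independence_number_ge (G : sgraph) (A : {set G}) :
  independent A -> #|A| <= independence_number G.
Proof. by move=> indA; apply: (bigmax_sup A). Qed.

Lemma color_class_independent (G : sgraph) (m : nat) (d : {ffun G -> 'I_m})
    (A : {set G}) (j : 'I_m) :
  proper_coloring d -> {in A, forall u, d u = j} -> independent A.
Proof.
move=> /forallP dP dA; apply/forall_inP => u uA; apply/forall_inP => v vA.
apply/negP => uv; have /forallP/(_ v)/implyP/(_ uv) := dP u.
by rewrite !dA // eqxx.
Qed.

(** The neighbor of color [c v] that the b-vertex [u] must have can only be [v]. *)
Lemma b_vertex_adj_singleton (G : sgraph) (k : nat) (c : {ffun G -> 'I_k})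
    (u v : G) :
  b_vertex c u -> c u != c v -> #|[set w | c w == c v]| = 1 -> adj u v.
Proof.
move=> /forallP/(_ (c v))/implyP bu ucv /eqP/cards1P[w classE].
have /existsP[x /andP[ux cx]] := bu (contra_neq esym ucv).
have : x \in [set w] by rewrite -classE inE.
have : v \in [set w] by rewrite -classE inE.
by move=> /set1P-> /set1P <-.
Qed.

Lemma b_coloring_bound (t k m : nat) (G : sgraph) (c : {ffun G -> 'I_k})
    (d : {ffun G -> 'I_m}) :
  0 < t -> independence_number G <= t -> b_coloring c -> proper_coloring d ->
  (2 * t - 1) * k <= (t - 1) * #|G| + t * m.
Proof.
move=> t_gt0 alpha_le /and3P[_ _ /forallP cb] dP.
pose f i := xchoose (existsP (cb i)).
have fP i : (c (f i) == i) && b_vertex c (f i) := xchooseP (existsP (cb i)).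
have cf i : c (f i) = i by case/andP: (fP i) => /eqP.
have fb i : b_vertex c (f i) by case/andP: (fP i).
pose cls i := [set u | c u == i].
pose w i := if #|cls i| == 1 then t else 1.
have cls_gt0 i : 0 < #|cls i|.
  by apply/card_gt0P; exists (f i); rewrite inE cf.
have sum_cls : \sum_i #|cls i| = #|G|.
  rewrite -sum1_card (partition_big c predT) //=.
  by apply: eq_bigr => i _; rewrite -sum1_card; apply: eq_bigl => u; rewrite inE.
have color_weight j : \sum_(i | d (f i) == j) w i <= t.
  have [/existsP[i /andP[/eqP dfi si]] | no_single] :=
    boolP [exists i, (d (f i) == j) && (#|cls i| == 1)].
  - rewrite (big_pred1 i) => [|i' /=]; first by rewrite /w si.
    (* A second index [i'] here would make [f i'] and [f i] adjacent with the same [d]-color. *)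
    apply/eqP/eqP => [dfi' | ->] //; apply: contraTeq isT => ii' /=.
    have uv : adj (f i') (f i).
      by apply: b_vertex_adj_singleton (fb i') _ _; rewrite !cf //; exact/eqP.
    have /forallP/(_ (f i'))/forallP/(_ (f i)) := dP.
    by rewrite uv dfi dfi' eqxx.
  - rewrite (eq_bigr (fun=> 1)) => [|i dfi]; last first.
      rewrite /w ifN //; apply: contra no_single => si.
      by apply/existsP; exists i; rewrite dfi.
    (* [c] is a left inverse of [f], so these classes are as many as their chosen b-vertices, an
       independent set. *)
    rewrite sum1dep_card -(card_imset _ (can_inj cf)).
    apply: leq_trans alpha_le; apply: independence_number_ge.
    apply: (color_class_independent _ _ _ _ j dP) => _ /imsetP[i + ->].
    by rewrite inE => /eqP.
have sum_w : \sum_i w i <= t * m.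
  rewrite (partition_big (fun i => d (f i)) predT) //=.
  have -> : t * m = \sum_(j < m) t by rewrite sum_nat_const card_ord mulnC.
  by apply: leq_sum => j _; exact: color_weight.
rewrite -sum_cls big_distrr /=.
apply: leq_trans (leq_add (leqnn _) sum_w); rewrite -big_split /=.
have -> : (2 * t - 1) * k = \sum_(i < k) (2 * t - 1).
  by rewrite sum_nat_const card_ord mulnC.
apply: leq_sum => i _; move: (cls_gt0 i); rewrite /w.
(* Size 1 gives exactly (t - 1) + t; size at least 2 gives at least 2(t - 1) + 1. *)
by case: eqP => [->|]; nia.
Qed.

Theorem corollary1 (t : nat) (G : sgraph) (t_ge1 : 1 <= t) (G_gt0 : 0 < #|G|)
    (alpha_le : independence_number G <= t) :
  (2 * t - 1) * b_chromatic_number G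
    <= (t - 1) * #|G| + t * chromatic_number G.
Proof.
rewrite /chromatic_number; case: ex_minnP => m /existsP[d dP] _.
rewrite /b_chromatic_number; elim/big_ind: _ => [|x y xP yP|k /existsP[c cP]].
- by rewrite muln0.
- by rewrite maxnMr geq_max xP.
- exact: b_coloring_bound cP dP.
Qed.
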